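(* Consider the stochastic coalitional game $G_{\mathbb{P}}=\{\mathcal{N},\{u_S\}_{S\subseteq\mathcal{N}},\Xi,\mathbb{P}\}$ and assume: (1) for every $S\subset\mathcal{N}$, $u_S(\xi)=\max_{m_S=1,\dots,M_S}u_{m_S}(\xi)$, where each $-u_{m_S}$, $m_S\in\{1,\dots,M_S\}$, is proper, convex and lower semicontinuous; (2) for every $S\subset\mathcal{N}$, $u_S$ does not take the value $-\infty$ on $\Xi$; (3) the support set $\Xi\subseteq\mathbb{R}^p$ is closed and convex. For each $S\subset\mathcal{N}$ let $\xi^{(1)},\dots,\xi^{(K_S)}\in\Xi$ be the $K_S$ samples drawn by coalition $S$, let $\epsilon_S>0$, and let $\hat{\mathcal{P}}_{K_S}=\mathbb{B}_{\epsilon_S}(\hat{\mathbb{P}}_{K_S})$. Then an allocation inside the distributionally robust core $C_{\mathrm{DR}}(G_{\hat{\mathcal{P}}_K})$ is found by solving the optimization problem $$P:\ \left\{\begin{aligned} &\min_{x,\{\lambda_S,\ell_{k_S},z_{k_Sm_S},v_{k_Sm_S}\}_{S\subset\mathcal{N}}}\ \|x\|_2^2\\ &\text{s.t. }\ \sum_{i\in\mathcal{N}}x_i=u_{\mathcal{N}},\\ &\lambda_S\epsilon_S+\frac1{K_S}\sum_{k_S=1}^{K_S}\ell_{k_S}\le\sum_{i\in S}x_i,\quad\forall S\subset\mathcal{N},\\ &[-u_{m_S}]^*(z_{k_Sm_S}-v_{k_Sm_S})+\sigma_\Xi(v_{k_Sm_S})-z_{k_Sm_S}^\top\xi^{(k_S)}\le\ell_{k_S},\quad\forall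 k_S,\ \forall m_S,\ \forall S\subset\mathcal{N},\\ &\|z_{k_Sm_S}\|_*\le\lambda_S,\quad\forall k_S,\ \forall m_S,\ \forall S\subset\mathcal{N}, \end{aligned}\right.$$ that is, the $x$-component of any optimal solution of $P$ belongs to $C_{\mathrm{DR}}(G_{\hat{\mathcal{P}}_K})$.
   Context: Agents: $\mathcal{N}=\{1,\dots,N\}$. $S\subset\mathcal{N}$ means a proper subset (a subcoalition). The uncertainty $\xi$ takes values in $\Xi\subseteq\mathbb{R}^p$. Each subcoalition $S$ has a value function $u_S$ of $\xi$; the grand coalition's value $u_{\mathcal{N}}\in\mathbb{R}$ is deterministic. $\mathcal{M}(\Xi)$ is the set of probability distributions $\mathbb{Q}$ supported on $\Xi$ with $\int_\Xi\|\xi\|\,\mathbb{Q}(d\xi)<\infty$, where $\|\cdot\|$ is a fixed norm on $\mathbb{R}^p$. The Wasserstein distance is $d_W(\mathbb{Q}_1,\mathbb{Q}_2)=\inf_\Pi\int_{\Xi^2}\|\xi_1-\xi_2\|\,\Pi(d\xi_1,d\xi_2)$, the infimum being over joint distributions $\Pi$ with marginals $\mathbb{Q}_1,\mathbb{Q}_2$. $\hat{\mathbb{P}}_{K_S}$ is the empirical distribution placing mass $1/K_S$ on each sample $\xi^{(k_S)}$, $k_S=1,\dots,K_S$, of coalition $S$, and $\mathbb{B}_{\epsilon_S}(\hat{\mathbb{P}}_{K_S})=\{\mathbb{Q}_S\in\mathcal{M}(\Xi):\ d_W(\hat{\mathbb{P}}_{K_S},\mathbb{Q}_S)\le\epsilon_S\}$.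 Distributionally robust (DR) core: $$C_{\mathrm{DR}}(G_{\hat{\mathcal{P}}_K})=\Big\{x\in\mathbb{R}^N:\ \sum_{i\in\mathcal{N}}x_i=u_{\mathcal{N}},\ \sum_{i\in S}x_i\ge\sup_{\mathbb{Q}_S\in\hat{\mathcal{P}}_{K_S}}\mathbb{E}_{\mathbb{Q}_S}[u_S(\xi)]\ \ \forall S\subset\mathcal{N}\Big\}.$$ Standing assumption: for all multi-samples the ambiguity sets are such that the DR core is non-empty. In $P$, for each $S$ the indices range over $k_S\in\{1,\dots,K_S\}$ and $m_S\in\{1,\dots,M_S\}$; the variables are $x\in\mathbb{R}^N$, $\lambda_S,\ell_{k_S}\in\mathbb{R}$, $z_{k_Sm_S},v_{k_Sm_S}\in\mathbb{R}^p$ (a separate family for each $S$). $[f]^*(y)=\sup_{x\in\mathrm{dom}(f)}(y^\top x-f(x))$ is the conjugate of $f$ (the functions $-u_{m_S}$ are extended-real-valued on $\mathbb{R}^p$), $\|\cdot\|_*$ is the dual norm of $\|\cdot\|$, and $\sigma_\Xi(v)=\sup_{\xi\in\Xi}v^\top\xi$ is the conjugate of the characteristic (indicator) function of $\Xi$. *)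

(* Defs.v *)
From HB Require Import structures.
From mathcomp Require Import all_boot all_order all_algebra.
From mathcomp Require Import all_classical all_reals all_analysis.

Set Implicit Arguments.
Unset Strict Implicit.
Unset Printing Implicit Defensive.

Import Order.TTheory GRing.Theory Num.Theory.
Import numFieldNormedType.Exports.

Local Open Scope classical_set_scope.
Local Open Scope ring_scope.

Section ConvexAnalysis.
Context {R : realType} {p : nat}.
Local Notation V := 'rV[R]_p.
Implicit Types (f : V -> \bar R) (nrm : V -> R) (v x y : V) (Xi : set V).

Definition dot x y : R := \sum_(i < p) x ord0 i * y ord0 i.

(* An arbitrary norm on R^p; the norm that the library puts on row vectors is
   the sup norm and only serves to define the (unique) usual topology. *)
Record is_norm nrm : Prop := IsNorm {
  norm_triangle : forall x y, nrm (x + y) <= nrm x + nrm y;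
  norm_homog : forall (a : R) x, nrm (a *: x) = `|a| * nrm x;
  norm_definite : forall x, nrm x = 0 -> x = 0 }.

Definition dual_norm nrm y : \bar R :=
  ereal_sup [set (dot y x)%:E | x in [set x | nrm x <= 1]].

Definition proper_fun f : Prop :=
  (exists x, f x < +oo)%E /\ (forall x, -oo < f x)%E.

(* Convexity of an extended-real-valued function is convexity of its epigraph,
   which avoids any convention for +oo - oo and 0 * oo. *)
Definition convex_efun f : Prop :=
  convex_set [set xa : V * R^o | (f xa.1 <= (xa.2 : R)%:E)%E].

Definition conjugate f y : \bar R :=
  ereal_sup [set (dot y x)%:E - f x | x in [set x | f x < +oo]]%E.

Definition support_fun Xi v : \bar R :=
  ereal_sup [set (dot v xi)%:E | xi in Xi].

End ConvexAnalysis.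

(* R^p with its Borel sigma-algebra. *)
Notation borelV R p := (g_sigma_algebraType (@open 'rV[R]_p)).


Section Empirical.
Context {R : realType} {p : nat}.
Local Open Scope ereal_scope.
Variables (K : nat) (xs : 'I_K -> borelV R p).

Definition empirical (A : set (borelV R p)) : \bar R :=
  (K%:R^-1)%:E * \sum_(k < K) \d_(xs k) A.

Let empiricalE : exists mu : {measure set (borelV R p) -> \bar R},
  empirical = mu.
Proof.
have K0 : (0 <= K%:R^-1 :> R)%R by rewrite invr_ge0 ler0n.
pose g n : borelV R p := if insub n is Some k then xs k else point.
exists (mscale (NngNum K0) (msum (fun n => \d_(g n)) K)).
apply/funext => A; rewrite /empirical /mscale /msum /=.
by congr (_ * _); apply: eq_bigr => k _; rewrite /g valK.
Qed.

Let empirical0 : empirical set0 = 0.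
Proof. by have [mu ->] := empiricalE. Qed.

Let empirical_ge0 A : 0 <= empirical A.
Proof. by have [mu ->] := empiricalE. Qed.

Let empirical_sigma_additive : semi_sigma_additive empirical.
Proof. by have [mu ->] := empiricalE; exact: measure_semi_sigma_additive. Qed.

HB.instance Definition _ := isMeasure.Build _ _ _ empirical
  empirical0 empirical_ge0 empirical_sigma_additive.

Lemma empirical_setT : (0 < K)%N -> empirical setT = 1.
Proof.
move=> K0; rewrite /empirical (eq_bigr (fun=> 1)) => [|k _]; last first.
  by rewrite diracT.
rewrite sumEFin big_const_ord iter_addr_0 -EFinM mulVf//.
by rewrite pnatr_eq0 -lt0n.
Qed.

End Empirical.

Section Wasserstein.
Context {R : realType} {p : nat}.
Local Open Scope ereal_scope.
Local Notation V := 'rV[R]_p.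
Local Notation E := (borelV R p).
Implicit Types (nrm : V -> R) (Xi : set V).

Definition finite_moment nrm Xi : set (probability E R) :=
  [set Q : probability E R | Q Xi = 1 /\ \int[Q]_(xi in Xi) (nrm xi)%:E < +oo].

Definition coupling (Q1 Q2 : {measure set E -> \bar R}) :
    set (probability (E * E)%type R) :=
  [set Pi | forall A : set E, measurable A ->
     Pi (A `*` setT) = Q1 A /\ Pi (setT `*` A) = Q2 A].

Definition wasserstein nrm Xi (Q1 Q2 : {measure set E -> \bar R}) : \bar R :=
  ereal_inf [set \int[Pi]_(z in Xi `*` Xi) (nrm (z.1 - z.2)%R)%:E
            | Pi in coupling Q1 Q2].

Definition wasserstein_ball nrm Xi (eps : R) (P : {measure set E -> \bar R}) :
    set (probability E R) :=
  [set Q | finite_moment nrm Xi Q /\ wasserstein nrm Xi P Q <= eps%:E].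

End Wasserstein.

(* Proper subsets of the set of agents; the empty set is one of them. *)
Definition subcoalition (N : nat) : Type :=
  {S : {set 'I_N} | S \proper [set: 'I_N]%SET}.

(* [law] is the true distribution of the uncertainty; it is unknown to the
   agents and neither the core nor the program below depends on it. *)
Record game (R : realType) (N p : nat) := Game {
  value : subcoalition N -> 'rV[R]_p -> \bar R;
  grand_value : R;
  uncertainty : set 'rV[R]_p;
  law : probability (borelV R p) R;
  law_uncertainty : law uncertainty = 1%E }.

Section Core.
Context {R : realType} {N p : nat}.
Variable (G : game R N p).

(* The integral is the expectation in \bar R: for Q with finite first moment and
   u_S a finite maximum of concave functions its positive part is finite. *)
Definition DR_core (amb : subcoalition N -> set (probability (borelV R p) R)) :
    set 'rV[R]_N :=
  [set x | \sum_(i < N) x ord0 i = grand_value G /\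
     forall S : subcoalition N,
       (ereal_sup [set \int[Q]_(xi in uncertainty G) value G S xi | Q in amb S]
        <= (\sum_(i in sval S) x ord0 i)%:E)%E].

Definition multisample (K : subcoalition N -> nat) : Type :=
  forall S : subcoalition N, 'I_(K S) -> 'rV[R]_p.

Definition wasserstein_amb (nrm : 'rV[R]_p -> R) (eps : subcoalition N -> R)
    (K : subcoalition N -> nat) (xs : multisample K) (S : subcoalition N) :
    set (probability (borelV R p) R) :=
  wasserstein_ball nrm (uncertainty G) (eps S) (empirical (xs S)).

End Core.

Arguments multisample R {N} p K.

Section Program.
Context {R : realType} {N p : nat}.
Variables (G : game R N p) (nrm : 'rV[R]_p -> R).
Variables (K M : subcoalition N -> nat).
Variable um : forall S : subcoalition N, 'I_(M S) -> 'rV[R]_p -> \bar R.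
Variables (eps : subcoalition N -> R) (xs : multisample R p K).

Record decision := Decision {
  alloc : 'rV[R]_N;
  lambda : subcoalition N -> R;
  ell : forall S : subcoalition N, 'I_(K S) -> R;
  zvar : forall S : subcoalition N, 'I_(K S) -> 'I_(M S) -> 'rV[R]_p;
  vvar : forall S : subcoalition N, 'I_(K S) -> 'I_(M S) -> 'rV[R]_p }.

Definition objective (d : decision) : R := \sum_(i < N) alloc d ord0 i ^+ 2.

Definition feasible (d : decision) : Prop :=
  [/\ \sum_(i < N) alloc d ord0 i = grand_value G,
      forall S, lambda d S * eps S + (K S)%:R^-1 * \sum_(k < K S) ell d k
                <= \sum_(i in sval S) alloc d ord0 i,
      forall S (k : 'I_(K S)) (m : 'I_(M S)),
        (conjugate (fun xi => - um m xi) (zvar d k m - vvar d k m)%R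
         + support_fun (uncertainty G) (vvar d k m)
         - (dot (zvar d k m) (xs k))%:E <= (ell d k)%:E)%E &
      forall S (k : 'I_(K S)) (m : 'I_(M S)),
        (dual_norm nrm (zvar d k m) <= (lambda d S)%:E)%E].

Definition optimal (d : decision) : Prop :=
  feasible d /\ forall d', feasible d' -> objective d <= objective d'.

End Program.

Arguments decision R {N} p K M.

(* Main.v *)
(* Only the easy half of the duality is needed: every feasible point of [P], not
   just an optimal one, has its allocation in the core.  By Fenchel-Young, the
   conjugate constraints give
     u_S(xi) <= l_k + z_km . (xi^(k) - xi) <= l_k + lambda_S ||xi^(k) - xi||
   for all xi in Xi and all k.  Integrating against an almost optimal coupling
   of the empirical law with Q bounds E_Q[u_S] by
   lambda_S eps_S + (1/K_S) sum_k l_k, hence by the budget of S. *)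
Require Import Defs.
From mathcomp Require Import all_boot all_order all_algebra.
From mathcomp Require Import all_classical all_reals all_analysis.
From mathcomp Require Import measurable_realfun lra.

Set Implicit Arguments.
Unset Strict Implicit.
Unset Printing Implicit Defensive.

Import Order.TTheory GRing.Theory Num.Theory.
Import numFieldNormedType.Exports.

Local Open Scope classical_set_scope.
Local Open Scope ring_scope.

(** * Arbitrary norms on R^p: continuity and the dual norm *)

Section Norm.
Context {R : realType} {p : nat}.
Variable nrm : 'rV[R]_p -> R.
Hypothesis nrm_norm : is_norm nrm.

Let nrm0 : nrm 0 = 0.
Proof. by rewrite -(scale0r 0) (norm_homog nrm_norm) normr0 mul0r. Qed.

Lemma is_normN x : nrm (- x) = nrm x.
Proof. by rewrite -scaleN1r (norm_homog nrm_norm) normrN1 mul1r. Qed.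

Lemma is_norm_ge0 x : 0 <= nrm x.
Proof.
have := norm_triangle nrm_norm x (- x).
by rewrite subrr nrm0 is_normN -mulr2n pmulrn_lge0.
Qed.

Lemma is_norm_sum (I : Type) (s : seq I) (f : I -> 'rV[R]_p) :
  nrm (\sum_(i <- s) f i) <= \sum_(i <- s) nrm (f i).
Proof.
elim/big_ind2 : _ => [|x a y b xa yb|//]; first by rewrite nrm0.
exact: le_trans (norm_triangle nrm_norm _ _) (lerD xa yb).
Qed.

Let C : R := \sum_(i < p) nrm (delta_mx ord0 i).

(** Expand [x] in the standard basis. Together with the reverse triangle inequality this makes [nrm]
    Lipschitz, hence continuous, for the sup norm. *)
Lemma is_norm_le_mx_norm x : nrm x <= `|x| * C.
Proof.
rewrite {1}[x]row_sum_delta; apply: le_trans (is_norm_sum _ _) _.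
rewrite mulr_sumr; apply: ler_sum => i _.
rewrite (norm_homog nrm_norm) ler_wpM2r ?is_norm_ge0//.
by rewrite [leRHS]mx_normrE (le_bigmax _ (fun ij => `|x ij.1 ij.2|) (ord0, i)).
Qed.

Lemma is_norm_dist x y : `|nrm x - nrm y| <= nrm (x - y).
Proof.
have sub a b : nrm a - nrm b <= nrm (a - b).
  by rewrite lerBlDr -{1}(subrK b a) (norm_triangle nrm_norm).
by rewrite ler_norml sub andbT lerNl opprB -(is_normN (x - y)) opprB sub.
Qed.

Lemma is_norm_continuous (a : 'rV[R]_p) :
  continuous (fun x : 'rV[R]_p => nrm (a - x)).
Proof.
move=> x A /nbhs_ballP[e /= e0 eA].
(* [C] is an empty sum when [p] is 0; adding 1 keeps the radius [e / (C + 1)] well defined. *)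
have C1 : 0 < C + 1.
  by rewrite ltr_wpDl// sumr_ge0// => i _; exact: is_norm_ge0.
apply/nbhs_ballP; exists (e / (C + 1)) => /=; first by rewrite divr_gt0.
move=> y; rewrite -ball_normE /= ltr_pdivlMr// => xye.
apply: eA; rewrite -ball_normE /=.
apply: le_lt_trans (is_norm_dist _ _) _.
rewrite -is_normN opprB [X in nrm X](_ : _ = x - y); last first.
  by rewrite opprB addrC addrA subrK.
apply: le_lt_trans (is_norm_le_mx_norm _) _; apply: le_lt_trans xye.
by rewrite ler_wpM2l// lerDl.
Qed.

(** Rescaling a nonzero [x] to norm 1 gives a competitor in the supremum that defines the dual
    norm. *)
Lemma dual_norm_le_dot z l x :
  (dual_norm nrm z <= l%:E)%E -> dot z x <= l * nrm x.
Proof.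
move=> zl; have [x0|x0] := eqVneq (nrm x) 0.
  rewrite (norm_definite nrm_norm x0) nrm0 mulr0 /dot big1// => i _.
  by rewrite mxE mulr0.
have nx0 : 0 < nrm x by rewrite lt_neqAle eq_sym x0 is_norm_ge0.
have dotZ : dot z ((nrm x)^-1 *: x) = (nrm x)^-1 * dot z x.
  by rewrite /dot mulr_sumr; apply: eq_bigr => i _; rewrite mxE mulrCA.
rewrite -ler_pdivrMr// mulrC -dotZ -lee_fin; apply: le_trans zl.
apply: ereal_sup_ubound; exists ((nrm x)^-1 *: x) => //=.
by rewrite (norm_homog nrm_norm) gtr0_norm ?invr_gt0// mulVf.
Qed.

(** The zero vector is a competitor. This is where the nonnegativity of the multipliers [lambda d S]
    comes from. *)
Lemma dual_norm_ge0 z : (0 <= dual_norm nrm z)%E.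
Proof.
apply: ereal_sup_ubound; exists 0 => /=; first by rewrite nrm0.
by congr EFin; rewrite /dot big1// => i _; rewrite mxE mulr0.
Qed.

End Norm.

(** * Borel measurability on R^p *)

Section Borel.
Context {R : realType} {p : nat}.
Local Notation V := 'rV[R]_p.
Local Notation E := (borelV R p).

Lemma open_borel (A : set V) : open A -> measurable (A : set E).
Proof. exact: sub_sigma_algebra. Qed.

Lemma closed_borel (A : set V) : closed A -> measurable (A : set E).
Proof. by move=> /closed_openC/open_borel/measurableC; rewrite setCK. Qed.

Lemma set1_borel (x : V) : measurable ([set x] : set E).
Proof.
apply: closed_borel; apply: accessible_closed_set1.
exact: hausdorff_accessible (@norm_hausdorff _ V).
Qed.

Lemma continuous_borel (f : V -> R) :
  continuous f -> measurable_fun setT (f : E -> R).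
Proof.
move=> /continuousP cf; apply: (measurability _ (RGenOpens.measurableE R)).
move=> _ [_ [a [b ->] <-]]; rewrite setTI; apply: open_borel.
exact/cf/interval_open.
Qed.

Lemma lower_semicontinuous_borel (f : V -> \bar R) :
  lower_semicontinuous f -> measurable_fun setT (f : E -> \bar R).
Proof.
move=> /lower_semicontinuousP scif.
apply: (measurability _ (ErealGenOInfty.measurableE R)).
move=> /= _ [_ [a ->]] <-; rewrite setTI preimage_itvoy.
apply: open_borel; exact: scif.
Qed.

End Borel.

(** * Finite maxima, comparison of integrals and change of variables *)

Lemma measurable_bigmaxe d (T : measurableType d) (R : realType) (D : set T)
    (I : Type) (s : seq I) (f : I -> T -> \bar R) :
  (forall i, measurable_fun D (f i)) ->
  measurable_fun D (fun x => \big[maxe/-oo%E]_(i <- s) f i x).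
Proof.
move=> mf; elim: s => [|i s IHs].
  by under eq_fun do rewrite big_nil; exact: measurable_cst.
under eq_fun do rewrite big_cons; exact: measurable_maxe.
Qed.

Section Integral.
Local Open Scope ereal_scope.
Context d (T : measurableType d) (R : realType).
Variable mu : {measure set T -> \bar R}.
Implicit Types f g : T -> \bar R.

(* Without measurability of [g], so that it applies to the transport cost
   without comparing the product and the Borel sigma-algebras of pairs. *)
Lemma ge0_le_integralT f g : (forall x, 0 <= f x) -> (forall x, f x <= g x) ->
  \int[mu]_x f x <= \int[mu]_x g x.
Proof.
move=> f0 fg; have g0 x : 0 <= g x by exact: le_trans (fg x).
rewrite !ge0_integralTE//; apply: ereal_sup_le => _ [h hf <-].
by exists h => // x; exact: le_trans (fg x).
Qed.

(** Passing from [f] to [g] raises the positive part and lowers the negative part, so integrals of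
    infinite value are covered too. *)
Lemma ae_le_integralT f g :
  measurable_fun setT f -> measurable_fun setT g ->
  (\forall x \ae mu, f x <= g x) -> \int[mu]_x f x <= \int[mu]_x g x.
Proof.
move=> mf mg fg; rewrite integralE [leRHS]integralE; apply: leeB.
- apply: ae_ge0_le_integral => //; try exact: measurable_funepos.
  apply: filterS fg => x fgx _; rewrite !funeposE.
  by rewrite ge_max !le_max fgx lexx orbT.
- apply: ae_ge0_le_integral => //; try exact: measurable_funeneg.
  apply: filterS fg => x fgx _; rewrite !funenegE.
  by rewrite ge_max !le_max leeN2 fgx lexx orbT.
Qed.

(** Meant for [phi] a projection and [nu] a marginal of a coupling; positive and negative parts are
    transported separately. *)
Lemma integral_pushforwardT d' (T' : measurableType d') (phi : T -> T')
    (nu : {measure set T' -> \bar R}) (f : T' -> \bar R) :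
  measurable_fun setT phi -> measurable_fun setT f ->
  (forall A, measurable A -> nu A = mu (phi @^-1` A)) ->
  \int[nu]_x f x = \int[mu]_x f (phi x).
Proof.
move=> mphi mf nuE; rewrite (eq_measure_integral (pushforward mu phi)).
  rewrite integralE [RHS]integralE; congr (_ - _).
  - rewrite (ge0_integral_pushforward mphi mu measurableT
      (measurable_funepos mf))//.
    by apply: eq_integral => x _; rewrite /= !funeposE.
  - rewrite (ge0_integral_pushforward mphi mu measurableT
      (measurable_funeneg mf))//.
    by apply: eq_integral => x _; rewrite /= !funenegE.
by move=> A mA _; exact: nuE.
Qed.

End Integral.

(** * Transport from the empirical law to a law on [Xi] *)

Section Transport.
Context {R : realType} {p : nat}.
Local Notation V := 'rV[R]_p.
Local Notation E := (borelV R p).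
Variables (nrm : V -> R) (Xi : set V) (K : nat) (xs : 'I_K -> V).
Hypothesis nrm_norm : is_norm nrm.
Hypothesis Xi_closed : closed Xi.
Hypothesis xs_Xi : forall k, Xi (xs k).

(* The samples may repeat: [mult k] counts the repetitions of [xs k], so that
   the normalised indicators of the [xs k] sum to 1 on the samples. *)
Let mult k : R := #|[pred j | xs j == xs k]|%:R.

Let mult_neq0 k : mult k != 0.
Proof. by rewrite pnatr_eq0 -lt0n; apply/card_gt0P; exists k; rewrite inE. Qed.

Let sum_weight k0 : \sum_(k | xs k == xs k0) (mult k)^-1 = 1.
Proof.
rewrite (eq_bigr (fun=> (mult k0)^-1)) => [|k /eqP xk]; last first.
  by rewrite /mult xk.
by rewrite big_const iter_addr_0 -mulr_natl mulfV ?mult_neq0.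
Qed.

Let empirical_set1 k :
  empirical (xs : 'I_K -> E) [set xs k] = (K%:R^-1 * mult k)%:E.
Proof.
rewrite /empirical EFinM; congr (_ * _)%E.
under eq_bigr do rewrite diracE.
rewrite sumEFin; congr EFin; rewrite /mult -sum1_card natr_sum.
rewrite [RHS]big_mkcond /=; apply: eq_bigr => j _.
rewrite inE; case: eqP => [xjk|xjk].
  by rewrite mem_set.
by rewrite memNset.
Qed.

(** The empirical law gives [[set xs k]] the mass [mult k / K], so dividing by [mult k] makes every
    [wt k] integrate to [1 / K] under any coupling. *)
Let wt k (z : E * E) : R := (mult k)^-1 * \1_([set xs k] `*` setT) z.

(* The transport cost, cut down to the pairs that start at a sample and end in
   [Xi]; every coupling of the empirical law with a law on [Xi] lives there. *)
Let trunc_cost (z : E * E) : R :=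
  \sum_(k < K) (mult k)^-1 * (\1_([set xs k] `*` Xi) z * nrm (xs k - z.2)).

Let indic_set1X k (B : set V) (z : E * E) :
  \1_([set xs k] `*` B) z = (xs k == z.1)%:R * \1_B z.2 :> R.
Proof.
rewrite !indicE -natrM mulnb; congr (_%:R); congr nat_of_bool.
apply/idP/andP => [|[/eqP xz] zB].
  by rewrite inE => -[/= -> ?]; rewrite eqxx mem_set.
by rewrite inE; split => //=; rewrite inE in zB.
Qed.

Let trunc_costE k0 (y : V) : Xi y -> trunc_cost (xs k0, y) = nrm (xs k0 - y).
Proof.
move=> Xiy; rewrite /trunc_cost -[RHS]mul1r -(sum_weight k0) mulr_suml.
rewrite [RHS]big_mkcond /=; apply: eq_bigr => k _.
rewrite indic_set1X /= indicE mem_set// mulr1.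
by case: eqP => [->|_]; rewrite ?mul1r// mul0r mulr0.
Qed.

(** At a pair starting at [xs k0] the weights form a convex combination supported on the indices
    that repeat this sample. *)
Let sum_wt k0 (y : V) (f : 'I_K -> R) c :
  (forall k, xs k = xs k0 -> c <= f k) ->
  c <= \sum_(k < K) wt k (xs k0, y) * f k.
Proof.
move=> cf; rewrite -[leLHS]mul1r -(sum_weight k0) mulr_suml big_mkcond /=.
apply: ler_sum => k _; rewrite /wt indic_set1X /= indicE in_setT mulr1.
case: eqP => [xk|_]; last by rewrite mulr0 mul0r.
by rewrite mulr1 ler_wpM2l ?invr_ge0// cf.
Qed.

Let trunc_cost_ge0 z : 0 <= trunc_cost z.
Proof.
apply: sumr_ge0 => k _; rewrite mulr_ge0 ?invr_ge0// mulr_ge0//.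
exact: is_norm_ge0.
Qed.

(** Both sides agree on pairs that start at a sample and end in [Xi], and the left one vanishes
    elsewhere. The bound holds at every point, as [ge0_le_integralT] requires. *)
Let trunc_cost_le (z : E * E) :
  ((trunc_cost z)%:E <=
   ((fun z => (nrm (z.1 - z.2)%R)%:E) \_ (Xi `*` Xi)) z)%E.
Proof.
have nrmE w : (0 <= (nrm w)%:E)%E by rewrite lee_fin is_norm_ge0.
have [[k0 zk0]|zN] := pselect (exists k, xs k = z.1); last first.
  rewrite /trunc_cost big1 => [|k _]; last first.
    by rewrite indic_set1X; case: eqP => [xz|]; [case: zN; exists k|];
      rewrite ?(mul0r, mulr0).
  by rewrite /patch; case: ifP => _; [exact: nrmE|exact: lexx].
case: z zk0 => _ y /= <-; rewrite /patch.
have [Xiy|nXiy] := pselect (Xi y).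
  rewrite mem_set; last by split; [exact: xs_Xi|].
  by rewrite trunc_costE.
rewrite memNset => [|[//]]; rewrite /trunc_cost big1// => k _.
by rewrite indic_set1X /= indicE memNset// mulr0 mul0r mulr0.
Qed.

Let Xi_borel : measurable (Xi : set E).
Proof. exact: closed_borel. Qed.

Let measurable_set1X k (B : set E) : measurable B ->
  measurable ([set xs k] `*` B : set (E * E)).
Proof. by move=> mB; apply: measurableX => //; exact: set1_borel. Qed.

Let measurable_trunc_cost : measurable_fun setT trunc_cost.
Proof.
apply: measurable_sum => k; apply: measurable_funM; first exact: measurable_cst.
apply: measurable_funM.
  by apply: measurable_indic; exact: measurable_set1X.
apply: (measurableT_comp (f := fun y : E => nrm (xs k - y))).
  by apply: continuous_borel; exact: is_norm_continuous.
exact: measurable_snd.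
Qed.

(** * The expectation bound along a single coupling *)

Section Coupling.
Variables (Q : probability E R) (Pi : probability (E * E)%type R).
Hypothesis QXi : Q Xi = 1%E.
Hypothesis PiQ : coupling (empirical (xs : 'I_K -> E)) Q Pi.

(** One null set per marginal: the empirical law charges only the samples, and [Q] only [Xi]. *)
Let coupling_support :
  \forall z \ae Pi, exists k0, xs k0 = z.1 /\ Xi z.2.
Proof.
have mxs : measurable (range xs : set E).
  apply: closed_borel; move/accessible_finite_set_closed :
    (hausdorff_accessible (@norm_hausdorff _ V)); apply.
  exact/finite_image/finite_finset.
have xsP : \forall z \ae Pi, range xs z.1.
  exists (~` (range xs : set E) `*` setT); split.
  - by apply: measurableX => //; exact: measurableC.
  - rewrite (PiQ (measurableC mxs)).1 /= /empirical big1 ?mule0// => k _.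
    by rewrite diracE memNset//; apply; exists k.
  - by move=> z /= zN; split.
have XiP : \forall z \ae Pi, Xi z.2.
  exists (setT `*` ~` (Xi : set E)); split.
  - by apply: measurableX => //; exact: measurableC.
  - rewrite (PiQ (measurableC Xi_borel)).2.
    by rewrite [LHS](probability_setC Q Xi_borel) QXi subee.
  - by move=> z /= zN; split.
apply: (@filterS2 _ _ (ae_filter_ringOfSetsType Pi) _ _ _ _ xsP XiP)
  => z [k _ xz] Xiz.
by exists k.
Qed.

Let integrable_wt k : Pi.-integrable setT (fun z => (wt k z)%:E).
Proof.
rewrite /wt; under eq_fun do rewrite EFinM.
apply: integrableZl => //.
by apply: integrable_indic; exact: measurable_set1X.
Qed.

Let integral_wt k : (\int[Pi]_z (wt k z)%:E = (K%:R^-1)%:E)%E.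
Proof.
rewrite /wt; under eq_integral do rewrite EFinM.
rewrite integralZl//; last first.
  by apply: integrable_indic; exact: measurable_set1X.
rewrite integral_indic//; last exact: measurable_set1X.
rewrite setIT [X in (_ * X)%E](_ : _ = (K%:R^-1 * mult k)%:E); last first.
  by rewrite -empirical_set1; exact: (PiQ (set1_borel _)).1.
by rewrite -EFinM mulrCA mulVf ?mulr1.
Qed.

Lemma coupling_expectation_le (u : V -> \bar R) (lam : R) (ell : 'I_K -> R) :
  0 <= lam -> measurable_fun (Xi : set E) (u : E -> \bar R) ->
  (forall k y, Xi y -> (u y <= (ell k + lam * nrm (xs k - y))%:E)%E) ->
  let C := (\int[Pi]_(z in Xi `*` Xi) (nrm (z.1 - z.2)%R)%:E)%E in
  (C < +oo)%E ->
  (\int[Q]_(y in Xi) u y <= lam%:E * C + (K%:R^-1 * \sum_(k < K) ell k)%:E)%E.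
Proof.
move=> lam0 mu uell C Coo.
(* [L] averages [ell] over the indices that repeat the starting sample; its integral is the plain
   average of all [ell k]. *)
pose L z : R := \sum_(k < K) wt k z * ell k.
have LE z : (L z)%:E = (\sum_(k < K) (ell k)%:E * (wt k z)%:E)%E.
  by rewrite -sumEFin; apply: eq_bigr => k _; rewrite mulrC EFinM.
have iL : Pi.-integrable setT (EFin \o L).
  rewrite (_ : _ \o _ = fun z => \sum_(k < K) (ell k)%:E * (wt k z)%:E)%E.
    by apply: integrable_sum => // k _; exact: integrableZl.
  exact/funext/LE.
have IL : (\int[Pi]_z (L z)%:E = (K%:R^-1 * \sum_(k < K) ell k)%:E)%E.
  under eq_integral do rewrite LE.
  rewrite integral_sum//; last by move=> k; exact: integrableZl.
  rewrite mulr_sumr -sumEFin; apply: eq_bigr => k _.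
  by rewrite integralZl// integral_wt -EFinM mulrC.
have CE : (\int[Pi]_z (trunc_cost z)%:E <= C)%E.
  rewrite /C [leRHS]integral_mkcond; apply: ge0_le_integralT => z.
    by rewrite lee_fin.
  exact: trunc_cost_le.
(* Finiteness of [C] makes the truncated cost integrable, so that the integral of the upper bound
   splits by linearity. *)
have iT : Pi.-integrable setT (EFin \o trunc_cost).
  apply/integrableP; split; first exact/measurable_EFinP.
  under eq_integral do rewrite /= ger0_norm//.
  exact: le_lt_trans Coo.
have iLT : Pi.-integrable setT (fun z => lam%:E * (trunc_cost z)%:E)%E.
  exact: integrableZl.
apply: (@le_trans _ _
  (\int[Pi]_z (lam%:E * (trunc_cost z)%:E + (L z)%:E))%E); last first.
  rewrite integralD// integralZl// IL leeD2r//.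
  by rewrite lee_wpmul2l ?lee_fin.
(* [Q] is the second marginal, so its integral becomes one over [Pi], and the two integrands can be
   compared pointwise on the support of the coupling. *)
rewrite integral_mkcond (integral_pushforwardT (mu := Pi) (phi := snd))//;
  last 2 first.
- exact: (measurable_restrictT (u : E -> \bar R) Xi_borel).1.
- move=> A mA; rewrite -(PiQ mA).2; congr (Pi _); apply/seteqP; split => z //=.
  by case.
apply: ae_le_integralT.
- apply: measurableT_comp; last exact: measurable_snd.
  exact: (measurable_restrictT (u : E -> \bar R) Xi_borel).1.
- apply: emeasurable_funD; last by move/integrableP : iL => [].
  by move/integrableP : iLT => [].
apply: (@filterS _ _ (ae_filter_ringOfSetsType Pi) _ _ _ coupling_support)
  => -[x y] /= [k0 [<- Xiy]].
rewrite /patch mem_set// trunc_costE// -EFinM -EFinD.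
(* For finite [u y], every index repeating [xs k0] gives the same lower bound on its [ell k], which
   [sum_wt] averages. The value +oo contradicts the bound at [k0]. *)
case: (u y) (fun k => uell k y Xiy) => [r| |] ruell; last by rewrite leNye.
  rewrite lee_fin addrC -lerBlDr; apply: sum_wt => k xk.
  by have := ruell k; rewrite lee_fin xk lerBlDr.
by have := ruell k0.
Qed.

End Coupling.

Lemma wasserstein_ball_expectation_le (u : V -> \bar R) (lam eps : R)
    (ell : 'I_K -> R) (Q : probability E R) :
  0 <= lam -> measurable_fun (Xi : set E) (u : E -> \bar R) ->
  (forall k y, Xi y -> (u y <= (ell k + lam * nrm (xs k - y))%:E)%E) ->
  wasserstein_ball nrm Xi eps (empirical (xs : 'I_K -> E)) Q ->
  (\int[Q]_(y in Xi) u y <=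
   (lam * eps + K%:R^-1 * \sum_(k < K) ell k)%:E)%E.
Proof.
move=> lam0 mu uell [[QXi _] Weps]; apply/lee_addgt0Pr => e e0.
have lam1 : 0 < lam + 1 by rewrite ltr_wpDl.
(* The infimum over couplings may not be attained. The slack is chosen so that
   [lam * (e / (lam + 1)) <= e], also when [lam] is 0. *)
have : (wasserstein nrm Xi (empirical (xs : 'I_K -> E)) Q <
        (eps + e / (lam + 1))%:E)%E.
  by apply: le_lt_trans Weps _; rewrite lte_fin ltrDl divr_gt0.
move=> /ereal_inf_lt[_ [Pi PiQ <-]] Cle.
apply: le_trans (coupling_expectation_le QXi PiQ lam0 mu uell _) _.
  exact: lt_trans Cle (ltry _).
apply: (@le_trans _ _ (lam%:E * (eps + e / (lam + 1))%:E
    + (K%:R^-1 * \sum_(k < K) ell k)%:E)%E).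
  by rewrite leeD2r// lee_wpmul2l ?lee_fin// ltW.
rewrite -!EFinM -!EFinD lee_fin mulrDr addrAC lerD2l mulrCA.
rewrite ler_piMr ?(ltW e0)//.
by rewrite ler_pdivrMr// mul1r lerDl.
Qed.

End Transport.

Section Dot.
Context {R : realType} {p : nat}.
Implicit Types x y z : 'rV[R]_p.

Lemma dotBl x y z : dot (x - y) z = dot x z - dot y z.
Proof.
by rewrite /dot -sumrB; apply: eq_bigr => i _; rewrite !mxE mulrBl.
Qed.

Lemma dotBr x y z : dot x (y - z) = dot x y - dot x z.
Proof.
by rewrite /dot -sumrB; apply: eq_bigr => i _; rewrite !mxE mulrBr.
Qed.

(* The easy half of conjugate duality: Fenchel-Young for [- u] and for the
   indicator of [Xi], whose dual variables [z - v] and [v] add up to [z]. *)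
Lemma conjugate_support_le (u : 'rV[R]_p -> \bar R) (Xi : set 'rV[R]_p)
    (z v x y : 'rV[R]_p) (l : R) :
  (u y < +oo)%E -> Xi y ->
  (conjugate (fun xi => - u xi) (z - v)%R + support_fun Xi v
     - (dot z x)%:E <= l%:E)%E ->
  (u y <= (l + dot z (x - y))%:E)%E.
Proof.
move=> uy Xiy dual.
(* If [u y] is -oo, then [y] lies outside the domain of [- u] and gives no competitor for the
   conjugate, but the claim is trivial. *)
case uyE : (u y) uy => [r| |]// _; last by rewrite leNye.
have : ((dot (z - v) y)%:E - - r%:E + (dot v y)%:E - (dot z x)%:E <= l%:E)%E.
  apply: le_trans dual; apply: leeD => //; apply: leeD; apply: ereal_sup_ubound.
  - by exists y; rewrite /= uyE ?ltry.
  - by exists y.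
by rewrite -!EFinN -!EFinD !lee_fin dotBl dotBr; lra.
Qed.

End Dot.

Theorem lemma2 (R : realType) (N p : nat) (nrm : 'rV[R]_p -> R)
    (G : game R N p)
    (M : subcoalition N -> nat)
    (um : forall S : subcoalition N, 'I_(M S) -> 'rV[R]_p -> \bar R)
    (K : subcoalition N -> nat) (xs : multisample R p K)
    (eps : subcoalition N -> R)
    (d : decision R p K M)
    (nrm_norm : is_norm nrm)
    (M_gt0 : forall S, (0 < M S)%N)
    (value_max : forall S xi, uncertainty G xi ->
       value G S xi = \big[maxe/-oo%E]_(m < M S) um S m xi)
    (um_proper : forall S m, proper_fun (fun xi => - um S m xi)%E)
    (um_convex : forall S m, convex_efun (fun xi => - um S m xi)%E)
    (um_lsc : forall S m, lower_semicontinuous (fun xi => - um S m xi)%E)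
    (value_gtNy : forall S xi, uncertainty G xi -> (-oo < value G S xi)%E)
    (support_closed : closed (uncertainty G))
    (support_convex : convex_set (uncertainty G))
    (K_gt0 : forall S, (0 < K S)%N)
    (xs_support : forall S k, uncertainty G (xs S k))
    (eps_gt0 : forall S, 0 < eps S)
    (core_neq0 : forall xs' : multisample R p K,
       (forall S k, uncertainty G (xs' S k)) ->
       DR_core G (wasserstein_amb G nrm eps xs') !=set0)
    (d_optimal : optimal G nrm um eps xs d) :
  DR_core G (wasserstein_amb G nrm eps xs) (alloc d).
Proof.
case: d_optimal => -[sum_alloc budget dual norm_le] _.
split=> // S; apply: ge_ereal_sup => _ [Q Qamb <-].
pose k0 := Ordinal (K_gt0 S); pose m0 := Ordinal (M_gt0 S).
(* Having at least one sample and one piece guarantees a dual norm constraint that bounds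
   [lambda d S] from below. *)
have lam0 : 0 <= lambda d S.
  by rewrite -lee_fin; apply: le_trans (norm_le S k0 m0); exact: dual_norm_ge0.
have mum m : measurable_fun setT (um S m : borelV R p -> \bar R).
  rewrite (_ : um S m = fun xi => - (- um S m xi))%E; last first.
    by apply/funext => xi; rewrite oppeK.
  by apply: measurableT_comp => //; exact: lower_semicontinuous_borel.
have mvalue : measurable_fun (uncertainty G : set (borelV R p))
    (value G S : borelV R p -> \bar R).
  (* The value is a maximum of the pieces only on the support, so measurability is taken relative to
     it. *)
  apply: (eq_measurable_fun (fun xi : borelV R p =>
    \big[maxe/-oo%E]_(m < M S) um S m xi)).
    by move=> xi /[1!inE] Xixi; rewrite value_max.
  by apply: measurable_bigmaxe => m; exact: measurable_funTS.
have value_le k y : uncertainty G y ->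
    (value G S y <= (ell d k + lambda d S * nrm (xs S k - y))%:E)%E.
  (* It suffices to bound each piece; the first subgoal is the default -oo of the maximum. *)
  move=> Xiy; rewrite value_max//; apply/bigmax_leP; split => [|m _].
    exact: leNye.
  have umy : (um S m y < +oo)%E by rewrite -lteN2 /=; exact: (um_proper S m).2.
  apply: le_trans (conjugate_support_le umy Xiy (dual S k m)) _.
  by rewrite lee_fin lerD2l; exact: dual_norm_le_dot.
have Q_le := wasserstein_ball_expectation_le nrm_norm
  support_closed (xs_support S) lam0 mvalue value_le Qamb.
by apply: le_trans Q_le _; rewrite lee_fin budget.
Qed.
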